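(* Let $k\ge 1$. A $GL(2,\mathbb{R})$ structure on a $(2k+1)$-dimensional manifold $M$ induces a conformal structure $[g]$ on $M$ of signature $(k+1,k)$ or $(k,k+1)$. A vector field $V$ on $M$ is null with respect to $[g]$ if and only if the polynomial corresponding to $V$ under the $GL(2,\mathbb{R})$ structure satisfies $I_0(V)=0$, where $I_0$ is the quadratic invariant of binary forms of degree $2k$.
   Context: A $GL(2,\mathbb{R})$ structure on a smooth $(n+1)$-dimensional manifold $M$ is a smooth bundle isomorphism $TM\cong S^n(\mathbb{S})$ (the $n$-th symmetric power), where $\mathbb{S}\to M$ is a real rank-two vector bundle. It identifies each tangent space with the space of homogeneous polynomials of degree $n$ in two variables, and is locally specified by a binary form with values in $T^*M$, $$Q(X_1,X_2)=\sum_{i=0}^n\binom{n}{i}\theta^{i+1}(X_1)^i(X_2)^{n-i},$$ where $\theta^1,\dots,\theta^{n+1}$ are linearly independent one-forms on $M$. If $V=\sum_i v^i\theta_i$ is a vector field, where $(\theta_i)$ is the frame dual to $(\theta^i)$, the polynomial corresponding to $V$ is the contraction of $V$ with $Q$, i.e. $\sum_{i=0}^n\binom{n}{i}v^{i+1}(X_1)^i(X_2)^{n-i}$. For $n=2k$ the quadratic invariant is $$I_0=\Big\{2\sum_{i=0}^{k-1}(-1)^i\binom{2k}{i}\theta^{i+1}\theta^{2k+1-i}\Big\}+\binom{2k}{k}(-1)^k(\theta^{k+1})^2 ,$$ regarded as a section of $S^2(T^*M)$; $I_0(V)$ is its value on $V$, obtained by replacing $\theta^j$ with $v^j$. Under the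 action of $GL(2,\mathbb{R})$ on $(X_1,X_2)$ it changes by a power of the determinant. A conformal structure is determined by its null vectors, i.e. the vectors $V$ with $g(V,V)=0$ for $g\in[g]$. *)

(* Defs.v *)
From HB Require Import structures.
From mathcomp Require Import all_boot all_order all_algebra.
From mathcomp Require Import all_classical all_reals all_analysis.

Set Implicit Arguments.
Unset Strict Implicit.
Unset Printing Implicit Defensive.

Import Order.TTheory GRing.Theory Num.Theory.
Import numFieldNormedType.Exports.

Local Open Scope classical_set_scope.
Local Open Scope ring_scope.

(* Vectors are rows, so linear maps act by right multiplication and, as for
   the library's [jacobian], the differential of f at x is v |-> v *m jacobian f x. *)

Section Smooth.
Variables (R : realType) (d : nat).

(* The iterated partial derivatives exist and are differentiable; meant for open U. *)
Fixpoint Cr (r : nat) (U : set 'rV[R]_d) (f : 'rV[R]_d -> R) : Prop :=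
  if r is s.+1 then
    (forall x, U x -> differentiable f x) /\
    (forall j : 'I_d, Cr s U (fun x => 'D_(delta_mx 0 j) f x))
  else forall x, U x -> {for x, continuous f}.

Definition Cinfty (U : set 'rV[R]_d) (f : 'rV[R]_d -> R) : Prop :=
  forall r, Cr r U f.

End Smooth.

(* A smooth structure is given by a (not necessarily maximal) smooth atlas.
   [chart_inv a] is only meaningful on the image of the chart a. *)
Record manifold (R : realType) (d : nat) := Manifold {
  point :> topologicalType;
  point_hausdorff : hausdorff_space point;
  point_second_countable : @second_countable point;
  chart : Type;
  chart_dom : chart -> set point;
  chart_map : chart -> point -> 'rV[R]_d;
  chart_inv : chart -> 'rV[R]_d -> point;
  chart_cover : forall p, exists a, chart_dom a p;
  chart_dom_open : forall a, open (chart_dom a);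
  chart_image_open : forall a, open (chart_map a @` chart_dom a);
  chart_mapK : forall a p, chart_dom a p -> chart_inv a (chart_map a p) = p;
  chart_map_continuous : forall a p, chart_dom a p ->
    {for p, continuous (chart_map a)};
  chart_inv_continuous : forall a x, (chart_map a @` chart_dom a) x ->
    {for x, continuous (chart_inv a)};
  chart_smooth : forall a b (j : 'I_d),
    Cinfty (chart_map a @` (chart_dom a `&` chart_dom b))
           (fun x => chart_map b (chart_inv a x) 0 j)
}.

Arguments chart_dom {R d} m a p.
Arguments chart_map {R d} m a p.
Arguments chart_inv {R d} m a x.

Section Tensors.
Variables (R : realType) (d : nat) (M : manifold R d).

Definition smooth_on (W : set M) (f : M -> R) : Prop :=
  forall a, Cinfty (chart_map M a @` (chart_dom M a `&` W))
                   (f \o chart_inv M a).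

(* Transition matrices of TM: the components of a tangent vector at p in the
   charts a and b are related by v_b = v_a *m tangent_trans a b p. *)
Definition tangent_trans (a b : chart M) (p : M) : 'M[R]_d :=
  jacobian (chart_map M b \o chart_inv M a) (chart_map M a p).

(* Tensor fields are given by their components in every chart; the values of
   component functions outside the domain of the chart are irrelevant. *)
Record vector_field := VectorField {
  vf_comp : chart M -> M -> 'rV[R]_d;
  vf_smooth : forall a j,
    smooth_on (chart_dom M a) (fun p => vf_comp a p 0 j);
  vf_trans : forall a b p, chart_dom M a p -> chart_dom M b p ->
    vf_comp b p = vf_comp a p *m tangent_trans a b p
}.

(* Pseudo-Riemannian metrics, of arbitrary signature. *)
Record metric := Metric {
  metric_comp : chart M -> M -> 'M[R]_d;
  metric_smooth : forall a i j,
    smooth_on (chart_dom M a) (fun p => metric_comp a p i j);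
  metric_sym : forall a p, chart_dom M a p ->
    (metric_comp a p)^T = metric_comp a p;
  metric_nondegenerate : forall a p, chart_dom M a p ->
    metric_comp a p \in unitmx;
  metric_trans : forall a b p, chart_dom M a p -> chart_dom M b p ->
    metric_comp a p =
    tangent_trans a b p *m metric_comp b p *m (tangent_trans a b p)^T
}.

Definition conformal (g h : metric) : Prop :=
  exists f : M -> R,
    [/\ smooth_on setT f, forall p, 0 < f p &
        forall a p, chart_dom M a p ->
          metric_comp h a p = f p *: metric_comp g a p].

Record conformal_structure := ConformalStructure {
  conf_class : set metric;
  conf_classP : exists g, conf_class = [set h | conformal g h]
}.

Definition mx_signature (p q : nat) (A : 'M[R]_d) : Prop :=
  (p + q)%N = d /\
  exists2 P : 'M[R]_d, P \in unitmx &
    P *m A *m P^T = diag_mx (\row_(i < d) (if (i < p)%N then 1 else -1)).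

Definition conf_signature (p q : nat) (C : conformal_structure) : Prop :=
  forall g, conf_class C g -> forall a x, chart_dom M a x ->
    mx_signature p q (metric_comp g a x).

(* V is null: g(V, V) = 0 identically on M, for g in the class. *)
Definition null (C : conformal_structure) (V : vector_field) : Prop :=
  forall g, conf_class C g -> forall a p, chart_dom M a p ->
    vf_comp V a p *m metric_comp g a p *m (vf_comp V a p)^T = 0.

(* Real rank-r bundles, presented by a trivialising open cover and a smooth
   GL(r, R)-valued cocycle: the components of a vector in the trivialisations
   a and b are related by s_b = s_a *m vb_trans a b p. *)
Record vector_bundle (r : nat) := VectorBundle {
  triv : Type;
  triv_dom : triv -> set M;
  vb_trans : triv -> triv -> M -> 'M[R]_r;
  triv_cover : forall p, exists a, triv_dom a p;
  triv_dom_open : forall a, open (triv_dom a);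
  vb_trans_smooth : forall a b i j,
    smooth_on (triv_dom a `&` triv_dom b) (fun p => vb_trans a b p i j);
  vb_trans_id : forall a p, triv_dom a p -> vb_trans a a p = 1%:M;
  vb_trans_cocycle : forall a b c p,
    triv_dom a p -> triv_dom b p -> triv_dom c p ->
    vb_trans a b p *m vb_trans b c p = vb_trans a c p
}.

End Tensors.

Arguments triv_dom {R d M r} v a p.
Arguments vb_trans {R d M r} v a b p.

(* The element of S^n(R^2) with coefficients v (v_i here is v^{i+1} in the
   usual one-based notation), as a function of X = (X_1, X_2)^T. *)
Definition binary_form (R : realType) (n : nat) (v : 'rV[R]_n.+1)
    (X : 'cV[R]_2) : R :=
  \sum_(i < n.+1)
     'C(n, i)%:R * v 0 i * X 0 0 ^+ i * X 1 0 ^+ (n - i).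

(* A smooth bundle isomorphism TM -> S^n(S), in local form: in the chart a of M
   and the trivialisation s of S it sends the tangent vector with components v
   to the binary form with coefficients v *m theta s a p, so that the columns of
   theta s a p are the components of the one-forms theta^1, ..., theta^{n+1}.
   The variables X_1, X_2 are the basis sections of S over the trivialisation.
   Since s_t = s_s *m G for G := vb_trans s t p, the basis sections for s are
   obtained from those for t as X_s = G *m X_t, and S^n of this change of basis
   is the substitution of G *m X for X. *)
Record GL2_structure (R : realType) (n : nat) (M : manifold R n.+1) := GL2Structure {
  spinor : vector_bundle M 2;
  theta : triv spinor -> chart M -> M -> 'M[R]_n.+1;
  theta_smooth : forall s a i j,
    smooth_on (triv_dom spinor s `&` chart_dom M a) (fun p => theta s a p i j);
  theta_iso : forall s a p, triv_dom spinor s p -> chart_dom M a p ->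
    theta s a p \in unitmx;
  theta_chart : forall s a b p,
    triv_dom spinor s p -> chart_dom M a p -> chart_dom M b p ->
    theta s a p = tangent_trans a b p *m theta s b p;
  theta_triv : forall s t a p,
    triv_dom spinor s p -> triv_dom spinor t p -> chart_dom M a p ->
    forall (v : 'rV[R]_n.+1) (X : 'cV[R]_2),
      binary_form (v *m theta t a p) X =
      binary_form (v *m theta s a p) (vb_trans spinor s t p *m X)
}.

(* The quadratic invariant of binary forms of degree 2k. *)
Definition I0 (R : realType) (k : nat) (v : 'rV[R]_(2 * k).+1) : R :=
  2%:R * (\sum_(i < k) (-1) ^+ i * 'C(2 * k, i)%:R
            * v 0 (inord i) * v 0 (inord (2 * k - i)))
  + 'C(2 * k, k)%:R * (-1) ^+ k * v 0 (inord k) ^+ 2.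

(* The polynomial corresponding to V, in a chart a and a trivialisation s. *)
Definition corresponding_form (R : realType) (n : nat) (M : manifold R n.+1)
    (G : GL2_structure M) (V : vector_field M)
    (s : triv (spinor G)) (a : chart M) (p : M) : 'rV[R]_n.+1 :=
  vf_comp V a p *m theta s a p.

Definition I0_vanishes (R : realType) (k : nat) (M : manifold R (2 * k).+1)
    (G : GL2_structure M) (V : vector_field M) : Prop :=
  forall s a p, triv_dom (spinor G) s p -> chart_dom M a p ->
    I0 (corresponding_form V s a p) = 0.

(* Main.v *)
Require Import Defs.
From HB Require Import structures.
From mathcomp Require Import all_boot all_order all_algebra.
From mathcomp Require Import all_classical all_reals all_analysis.
From mathcomp Require Import ring lra zify.
Import Order.TTheory GRing.Theory Num.Theory.
Import numFieldNormedType.Exports.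

Set Implicit Arguments.
Unset Strict Implicit.
Unset Printing Implicit Defensive.

(** The invariant I0 is the quadratic form of the apolar pairing of binary
    forms of degree n = 2k, whose Gram matrix [apolar R n] is antidiagonal with
    entries (-1)^i C(n, i).  Pairing the n-th power of a linear form with w
    amounts to evaluating w at the zero of that linear form
    ([apolar_power]); as such powers span all forms, a linear substitution G
    multiplies the pairing by (det G)^n ([apolar_equivariant]).  Since n is even
    this factor is positive, so the local metrics theta * apolar * theta^T
    attached to the trivialisations of the spinor bundle agree up to positive
    factors, and each transforms as a tensor under changes of chart.

    A sum of these local metrics with nonnegative smooth weights, locally finite
    and nowhere all zero, is therefore at each point a positive multiple of each
    of them: it is a global metric g0 ([exists_global_metric]) and its conformal
    class has exactly the vectors with I0 = 0 as null vectors.  The weights come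
    from smooth bumps built on exp(-1/t) ([bump]); second countability selects
    countably many of them, and damping the n-th one by the earlier ones makes
    the family locally finite ([locally_finite_bumps]).

    The signature is read off from the hyperbolic planes spanned by the
    coordinates i and n - i, which contribute k signs of each kind, and from the
    middle coordinate, which contributes the sign (-1)^k
    ([apolar_signature]).

    For uniqueness, let g be a metric for which every field with I0 = 0 is null.
    Through each vector with I0 = 0 there passes, up to a positive factor, a
    global field with I0 = 0, constant times a bump in the given frame
    ([null_field_through]); hence g vanishes on the null cone of the apolar
    pairing, and a quadratic form vanishing on that cone is a multiple of it
    ([apolar_cone]).  The dimension 2k + 1 being odd, the sign of the determinant
    fixes the sign of the multiple once the signature is prescribed
    ([mx_signature_scale]), so g is conformal to g0. *)

(** * Smooth functions on open subsets of Euclidean space *)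

Section Locality.
Local Open Scope classical_set_scope.
Local Open Scope ring_scope.

Lemma near_eq_differentiable (R : numFieldType) (V W : normedModType R)
    (f g : V -> W) (x : V) :
  (\near x, f x = g x) -> differentiable f x -> differentiable g x.
Proof.
move=> fg df.
have gx : g x = f x by rewrite (nbhs_singleton fg).
have [cdf fE] := (diff_locallyP _ _).1 df.
have gE : g \o shift x = cst (g x) + 'd f x +o_ (0 : V) id.
  apply/eqaddoP => _/posnumP[e].
  move/eqaddoP: fE => /(_ _ [gt0 of e%:num]) fE.
  have fg0 : \forall h \near 0, f (h + x) = g (h + x).
    by move: fg; rewrite (near_shift 0) /=; apply: filterS => h /=; rewrite subr0.
  by apply: filterS2 fE fg0 => h; rewrite !fctE /= gx => fE <-.
have dgE : 'd g x = 'd f x :> (V -> W) by exact: diff_unique.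
by apply/diff_locallyP; rewrite dgE.
Qed.

Lemma open_near (T : topologicalType) (U : set T) (P : T -> Prop) (x : T) :
  open U -> U x -> (forall y, U y -> P y) -> \forall y \near x, P y.
Proof. by move=> oU Ux UP; apply: filterS UP _; exact: open_nbhs_nbhs. Qed.

End Locality.

Section EuclideanCalculus.
Local Open Scope classical_set_scope.
Local Open Scope ring_scope.
Variables (R : realType) (d : nat).
Implicit Types (U W : set 'rV[R]_d) (f g : 'rV[R]_d -> R) (x : 'rV[R]_d).

(** Being C^r is a condition at each point separately; this is what allows
    smoothness to be checked on the members of a cover. *)
Lemma CrP r U f : Cr r U f <-> forall x, U x -> Cr r [set x] f.
Proof.
elim: r f => [|r IH] f /=.
  by split=> [H x Ux _ -> | H x Ux]; [exact: H | exact (H x Ux x erefl)].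
split=> [[df H] x Ux | H].
  split=> [_ -> | j]; first exact: df.
  exact: ((IH _).1 (H j)).
split=> [x Ux | j]; first exact ((H x Ux).1 x erefl).
by apply/IH => x Ux; exact: ((H x Ux).2 j).
Qed.

Lemma Cr_sub r U W f : W `<=` U -> Cr r U f -> Cr r W f.
Proof. by move=> WU /CrP H; apply/CrP => x /WU; exact: H. Qed.

Lemma Cr_eq r U f g : open U -> (forall x, U x -> f x = g x) ->
  Cr r U f -> Cr r U g.
Proof.
move=> oU; elim: r f g => [|r IH] f g fg.
  move=> /= H x Ux; rewrite /prop_for /continuous_at -(fg x Ux).
  exact: cvg_trans (near_eq_cvg (open_near oU Ux fg)) (H x Ux).
have nfg x : U x -> \near x, f x = g x.
  by move=> Ux; exact: open_near oU Ux fg.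
move=> [df H]; split=> [x Ux | j].
  exact: (near_eq_differentiable (nfg x Ux) (df x Ux)).
apply: (IH _ _ _ (H j)) => x Ux.
by apply: near_eq_derive; exact: nfg.
Qed.

Lemma CrW r U f : Cr r.+1 U f -> Cr r U f.
Proof.
elim: r f => [|r IH] f [df H].
  by move=> x Ux; apply: differentiable_continuous; exact: df.
by split=> // j; apply: IH; exact: H.
Qed.

Lemma Cr_cst r U (c : R) : Cr r U (fun=> c).
Proof.
elim: r c => [|r IH] c /=; first by move=> x _; exact: cst_continuous.
split=> [x _|j]; first exact: differentiable_cst.
have -> : (fun x => 'D_(delta_mx 0 j) (fun=> c) x) = fun=> 0 :> R.
  by apply/funext => x; rewrite derive_cst.
exact: IH.
Qed.

Lemma CrD r U f g : open U -> Cr r U f -> Cr r U g ->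
  Cr r U (fun x => f x + g x).
Proof.
move=> oU; elim: r f g => [|r IH] f g.
  by move=> cf cg x Ux; apply: (@continuousD _ _ _ f g); [exact: cf | exact: cg].
move=> [df Hf] [dg Hg]; split=> [x Ux|j].
  exact: (differentiableD (df x Ux) (dg x Ux)).
apply: (Cr_eq oU _ (IH _ _ (Hf j) (Hg j))) => x Ux.
exact: esym (deriveD (diff_derivable (df x Ux)) (diff_derivable (dg x Ux))).
Qed.

Lemma CrM r U f g : open U -> Cr r U f -> Cr r U g ->
  Cr r U (fun x => f x * g x).
Proof.
move=> oU; elim: r f g => [|r IH] f g.
  by move=> cf cg x Ux; apply: (@continuousM _ _ f g); [exact: cf | exact: cg].
move=> Cf Cg; have := Cf; have := Cg; move=> [dg Hg] [df Hf]; split=> [x Ux|j].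
  exact: (differentiableM (df x Ux) (dg x Ux)).
apply: (Cr_eq oU _ (CrD oU (IH _ _ (CrW Cf) (Hg j))
  (IH _ _ (CrW Cg) (Hf j)))) => x Ux.
exact: esym (deriveM (diff_derivable (df x Ux)) (diff_derivable (dg x Ux))).
Qed.

Lemma CrV r U f : open U -> (forall x, U x -> f x != 0) -> Cr r U f ->
  Cr r U (fun x => (f x)^-1).
Proof.
move=> oU f0; elim: r => [|r IH].
  move=> cf x Ux; apply: (@continuousV _ _ f); [exact: f0 | exact: cf].
move=> Cf; have := Cf => -[df Hf]; split=> [x Ux|j].
  by apply: (differentiableV (df x Ux)); exact: f0.
have CfV := IH (CrW Cf).
apply: (Cr_eq oU _ (CrM oU (Cr_cst r U (-1))
  (CrM oU (CrM oU CfV CfV) (Hf j)))) => x Ux.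
rewrite deriveV ?f0//; last exact: diff_derivable (df _ _).
by rewrite mulN1r expr2 invfM scaleNr.
Qed.

End EuclideanCalculus.

Section FlatFunction.
Local Open Scope classical_set_scope.
Local Open Scope ring_scope.
Variable R : realType.

(** The factor t^-n makes the family of these functions, n varying, closed under
    differentiation up to linear combination; each member is positive exactly on
    the positive half-line. *)
Definition flat (n : nat) (t : R) : R :=
  if 0 < t then t^-1 ^+ n * expR (- t^-1) else 0.

Lemma flat_gt0 n t : 0 < t -> 0 < flat n t.
Proof.
by move=> t0; rewrite /flat t0 mulr_gt0 ?expR_gt0// exprn_gt0// invr_gt0.
Qed.

Lemma flat_le0 n t : t <= 0 -> flat n t = 0.
Proof. by rewrite leNgt /flat => /negbTE ->. Qed.

Lemma flat_ge0 n t : 0 <= flat n t.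
Proof.
by have [/(flat_le0 n) -> //|/(flat_gt0 n)/ltW] := leP t 0.
Qed.

(** The quadratic bound gives differentiability at 0, with derivative 0.  It holds
    since exp(1/t) dominates its Taylor term (1/t)^(n+2) / (n+2)!. *)
Lemma flat_le_sqr n t : flat n t <= (n.+2)`!%:R * t ^+ 2.
Proof.
have [/(flat_le0 n) -> |t0] := leP t 0.
  by rewrite mulr_ge0// sqr_ge0.
rewrite /flat t0 expRN.
have u0 : 0 < t^-1 by rewrite invr_gt0.
have := expR_ge1Dxn n.+1 (ltW u0) => H.
have {H} : t^-1 ^+ n.+2 / (n.+2)`!%:R <= expR t^-1.
  by apply: le_trans H; rewrite lerDr.
have f0 : 0 < (n.+2)`!%:R :> R by rewrite ltr0n fact_gt0.
rewrite ler_pdivrMr// => H.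
rewrite ler_pdivrMr ?expR_gt0//.
rewrite -(ler_pM2r (exprn_gt0 2 u0)) -exprD addn2.
apply: (le_trans H).
rewrite [leRHS](_ : _ = expR t^-1 * (n.+2)`!%:R)// exprVn.
by field; rewrite gt_eqF.
Qed.

Lemma is_derive_flat n (t : R) :
  is_derive t (1 : R) (flat n) (- n%:R * flat n.+1 t + flat n.+2 t).
Proof.
have [t0|t0|->] := ltgtP t 0.
- rewrite !flat_le0 ?ltW// mulr0 addr0.
  apply: (@near_eq_is_derive _ _ _ (cst 0)).
  by near=> s; rewrite flat_le0//; apply/ltW; near: s; exact: lt_nbhsl.
- have tn0 : t != 0 by rewrite gt_eqF.
  have dV : is_derive t (1 : R) (fun s : R => s^-1) (- t ^- 2).
    apply: DeriveDef; first exact: derivableV (@derivable_id _ _ _ _).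
    by rewrite deriveV// derive_id [LHS]mulr1.
  apply: (@near_eq_is_derive _ _ _
    ((fun s : R => s^-1) ^+ n * (expR \o (- (fun s : R => s^-1))))).
    by near=> s; rewrite /flat ifT; [rewrite exprfctE | near: s; exact: lt_nbhsr].
  apply: is_derive_eq; rewrite /flat t0 !exprfctE /= /GRing.scale /=.
  rewrite -[(- _) t]/(- t^-1) -(exprVn t 2).
  have aux (u e : R) m : u ^+ m * (e * - - u ^+ 2)
      + e * (m%:R * u ^+ m.-1 * - u ^+ 2)
      = - m%:R * (u ^+ m.+1 * e) + u ^+ m.+2 * e.
    by case: m => [|m] /=; [ring | rewrite -natr1 !exprS; ring].
  exact: aux.
- rewrite !flat_le0// mulr0 addr0.
  have lim0 : (fun h : R => h^-1 *: ((flat n \o shift 0) (h *: 1) - flat n 0))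
      @ 0^' --> (0 : R).
    rewrite flat_le0//; apply/cvgr0Pnorm_le => e e0.
    near=> h; have h0 : h != 0 by near: h; exact: nbhs_dnbhs_neq.
    rewrite /= subr0 addr0 [h *: 1]mulr1 [_ *: _]mulrC normrM normfV.
    rewrite (ger0_norm (flat_ge0 _ _)) ler_pdivrMr ?normr_gt0//.
    apply: (le_trans (flat_le_sqr n h)).
    rewrite -real_normK ?num_real// expr2 mulrA ler_wpM2r//.
    rewrite mulrC -ler_pdivlMr ?ltr0n ?fact_gt0//.
    near: h; apply: dnbhs0_le; rewrite divr_gt0// ltr0n fact_gt0//.
  apply: DeriveDef; first by apply/cvg_ex; exists 0.
  exact: cvg_lim lim0.
Unshelve. all: by end_near. Qed.

(** Induction on r for all n at once, as differentiating raises n. *)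
Lemma Cr_flat d n r (U : set 'rV[R]_d) (f : 'rV[R]_d -> R) : open U ->
  Cr r U f -> Cr r U (fun x => flat n (f x)).
Proof.
move=> oU.
have diff_flat m t : differentiable (flat m) (t : R).
  by apply/derivable1_diffP; have [] := is_derive_flat m t.
elim: r n => [|r IH] n.
  move=> cf x Ux; apply: (@continuous_comp _ _ _ f (flat n)); first exact: cf.
  exact: differentiable_continuous.
move=> Cf; have := Cf => -[df Hf]; split=> [x Ux|j].
  exact: (differentiable_comp (df x Ux) (diff_flat n (f x))).
have CfW := CrW Cf.
apply: (Cr_eq oU _ (CrM oU (CrD oU (CrM oU (Cr_cst r U (- n%:R)) (IH n.+1 CfW))
  (IH n.+2 CfW)) (Hf j))) => x Ux.
have dfx := df x Ux.
rewrite [RHS](deriveE _ (differentiable_comp dfx (diff_flat n (f x)))).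
rewrite (diff_comp dfx (diff_flat n (f x))) /= diff1E// -deriveE//.
rewrite derive1E; have [_ ->] := is_derive_flat n (f x).
by rewrite [RHS]mulrC.
Qed.

End FlatFunction.

(** * Smooth functions on manifolds *)

Section ManifoldCalculus.
Local Open Scope classical_set_scope.
Local Open Scope ring_scope.
Variables (R : realType) (d : nat) (M : manifold R d).
Implicit Types (W : set M) (f g : M -> R) (p : M).

Lemma chart_image_openI (a : chart M) W : open W ->
  open (chart_map M a @` (chart_dom M a `&` W)).
Proof.
move=> oW; rewrite openE => _ [p [ap Wp] <-].
have ip : (chart_map M a @` chart_dom M a) (chart_map M a p) by exists p.
have nI := open_nbhs_nbhs (conj (@chart_image_open _ _ M a) ip).
have nW : nbhs (chart_map M a p) (chart_inv M a @^-1` W).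
  apply: (chart_inv_continuous ip); rewrite chart_mapK//.
  exact: open_nbhs_nbhs.
apply: filterS2 nI nW => y [q aq <-] /=.
by rewrite chart_mapK// => Wq; exists q.
Qed.

Lemma smooth_on_local W f :
  (forall p, W p -> exists2 W', W' p & smooth_on W' f) -> smooth_on W f.
Proof.
move=> H a r; apply/CrP => _ [p [ap Wp] <-].
have [W' W'p sf] := H p Wp.
by apply: Cr_sub (sf a r) => _ ->; exists p.
Qed.

Lemma smooth_on_sub W W' f : W' `<=` W -> smooth_on W f -> smooth_on W' f.
Proof. by move=> WW sf; apply: smooth_on_local => p /WW Wp; exists W. Qed.

Lemma smooth_on_eq W f g : open W -> (forall p, W p -> f p = g p) ->
  smooth_on W f -> smooth_on W g.
Proof.
move=> oW fg sf a r; apply: Cr_eq (sf a r); first exact: chart_image_openI.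
by move=> _ [p [ap Wp] <-] /=; rewrite chart_mapK// fg.
Qed.

Lemma smooth_on_cst W (c : R) : smooth_on W (fun=> c).
Proof. by move=> a r; exact: Cr_cst. Qed.

Lemma smooth_onD W f g : open W -> smooth_on W f -> smooth_on W g ->
  smooth_on W (fun p => f p + g p).
Proof.
by move=> oW sf sg a r; apply: CrD; [exact: chart_image_openI|exact: sf|exact: sg].
Qed.

Lemma smooth_onM W f g : open W -> smooth_on W f -> smooth_on W g ->
  smooth_on W (fun p => f p * g p).
Proof.
by move=> oW sf sg a r; apply: CrM; [exact: chart_image_openI|exact: sf|exact: sg].
Qed.

Lemma smooth_onV W f : open W -> (forall p, W p -> f p != 0) ->
  smooth_on W f -> smooth_on W (fun p => (f p)^-1).
Proof.
move=> oW f0 sf a r.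
apply: (@CrV _ _ _ _ (f \o chart_inv M a));
  [exact: chart_image_openI| |exact: sf].
by move=> _ [p [ap Wp] <-] /=; rewrite chart_mapK// f0.
Qed.

Lemma smooth_on_flat W n f : open W -> smooth_on W f ->
  smooth_on W (fun p => flat n (f p)).
Proof.
by move=> oW sf a r; apply: (@Cr_flat _ _ _ _ _ (f \o chart_inv M a));
  [exact: chart_image_openI|exact: sf].
Qed.

Lemma smooth_on_sum W (I : Type) (s : seq I) (P : pred I) (F : I -> M -> R) :
  open W -> (forall i, smooth_on W (F i)) ->
  smooth_on W (fun p => \sum_(i <- s | P i) F i p).
Proof.
move=> oW sF; elim: s => [|i s IH].
  by apply: smooth_on_eq (smooth_on_cst W 0) => // p _; rewrite big_nil.
have := smooth_onD oW (sF i) IH; case: (boolP (P i)) => Pi sD.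
  by apply: smooth_on_eq sD => // p _; rewrite big_cons Pi.
by apply: smooth_on_eq IH => // p _; rewrite big_cons (negbTE Pi).
Qed.

Lemma smooth_on_prod W (I : Type) (s : seq I) (P : pred I) (F : I -> M -> R) :
  open W -> (forall i, smooth_on W (F i)) ->
  smooth_on W (fun p => \prod_(i <- s | P i) F i p).
Proof.
move=> oW sF; elim: s => [|i s IH].
  by apply: smooth_on_eq (smooth_on_cst W 1) => // p _; rewrite big_nil.
have := smooth_onM oW (sF i) IH; case: (boolP (P i)) => Pi sD.
  by apply: smooth_on_eq sD => // p _; rewrite big_cons Pi.
by apply: smooth_on_eq IH => // p _; rewrite big_cons (negbTE Pi).
Qed.

Lemma smooth_on_continuous W f p : open W -> smooth_on W f -> W p ->
  {for p, continuous f}.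
Proof.
move=> oW sf Wp; have [a ap] := chart_cover p.
have cf : {for chart_map M a p, continuous (f \o chart_inv M a)}.
  by apply: (sf a 0%N); exists p.
have cm := chart_map_continuous ap.
have cfm := continuous_comp cm cf.
have E q : chart_dom M a q -> ((f \o chart_inv M a) \o chart_map M a) q = f q.
  by move=> aq /=; rewrite chart_mapK.
have nE := open_near (@chart_dom_open _ _ M a) ap E.
rewrite /prop_for /continuous_at -(E p ap).
exact: cvg_trans (near_eq_cvg nE) cfm.
Qed.

Lemma smooth_on_chart (a : chart M) (j : 'I_d) :
  smooth_on (chart_dom M a) (fun q => chart_map M a q 0 j).
Proof. by move=> b; exact: chart_smooth. Qed.

Section Matrices.
Variable W : set M.
Hypothesis oW : open W.

Definition smooth_mx m n (A : M -> 'M[R]_(m, n)) :=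
  forall i j, smooth_on W (fun p => A p i j).

Lemma smooth_mx_eq m n (A B : M -> 'M[R]_(m, n)) :
  (forall p, W p -> A p = B p) -> smooth_mx A -> smooth_mx B.
Proof. by move=> AB sA i j; apply: smooth_on_eq (sA i j) => // p /AB ->. Qed.

Lemma smooth_mx_cst m n (A : 'M[R]_(m, n)) : smooth_mx (fun=> A).
Proof. by move=> i j; exact: smooth_on_cst. Qed.

Lemma smooth_mxZ m n f (A : M -> 'M[R]_(m, n)) :
  smooth_on W f -> smooth_mx A -> smooth_mx (fun p => f p *: A p).
Proof.
move=> sf sA i j; apply: smooth_on_eq (smooth_onM oW sf (sA i j)) => // p _.
by rewrite mxE.
Qed.

Lemma smooth_mxM m n l (A : M -> 'M[R]_(m, n)) (B : M -> 'M[R]_(n, l)) :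
  smooth_mx A -> smooth_mx B -> smooth_mx (fun p => A p *m B p).
Proof.
move=> sA sB i j; have H k := smooth_onM oW (sA i k) (sB k j).
by apply: smooth_on_eq (smooth_on_sum _ _ oW H) => // p _; rewrite mxE.
Qed.

Lemma smooth_mx_tr m n (A : M -> 'M[R]_(m, n)) :
  smooth_mx A -> smooth_mx (fun p => (A p)^T).
Proof.
by move=> sA i j; apply: smooth_on_eq (sA j i) => // p _; rewrite mxE.
Qed.

Lemma smooth_mx_det n (A : M -> 'M[R]_n) :
  smooth_mx A -> smooth_on W (fun p => \det (A p)).
Proof.
move=> sA; apply: smooth_on_sum => // s; apply: smooth_onM => //.
  exact: smooth_on_cst.
by apply: smooth_on_prod.
Qed.

(** Cramer's rule. *)
Lemma smooth_mx_inv n (A : M -> 'M[R]_n) :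
  (forall p, W p -> A p \in unitmx) -> smooth_mx A ->
  smooth_mx (fun p => invmx (A p)).
Proof.
move=> uA sA.
apply: (@smooth_mx_eq _ _ (fun p => (\det (A p))^-1 *: \adj (A p))).
  by move=> p /uA Ap; rewrite /invmx Ap.
apply: smooth_mxZ.
  apply: smooth_onV => // [p /uA|]; last exact: smooth_mx_det.
  by rewrite unitmxE unitfE.
move=> i j; apply: (@smooth_on_eq _
    (fun p => (-1) ^+ (j + i) * \det (row' j (col' i (A p))))) => //.
  by move=> p _; rewrite mxE.
apply: smooth_onM => //; first exact: smooth_on_cst.
apply: smooth_mx_det => k l.
by apply: smooth_on_eq (sA (lift j k) (lift i l)) => // p _; rewrite !mxE.
Qed.

End Matrices.

End ManifoldCalculus.

(** * Bump functions and locally finite families *)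

Section Bumps.
Local Open Scope classical_set_scope.
Local Open Scope ring_scope.
Variables (R : realType) (d : nat) (M : manifold R d).
Implicit Types (U V W : set M) (f g : M -> R) (p : M).

Definition supported_in W f :=
  exists2 K : set M, closed K /\ K `<=` W & forall q, ~ K q -> f q = 0.

Lemma supported_in_off W f q : supported_in W f -> ~ W q -> f q = 0.
Proof. by move=> [K [_ KW] f0] nWq; apply: f0 => /KW. Qed.

Lemma supported_inM W f g : supported_in W f ->
  supported_in W (fun q => f q * g q).
Proof. by move=> [K cK f0]; exists K => // q /f0 ->; rewrite mul0r. Qed.

(** Extension by zero: the product is smooth near the support of f because g is
    smooth on W, and vanishes on the open complement of the support. *)
Lemma smooth_on_supported V W f g : open V -> open W -> supported_in W f ->
  smooth_on setT f -> smooth_on (W `&` V) g ->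
  smooth_on V (fun q => f q * g q).
Proof.
move=> oV oW [K [cK KW] f0] sf sg; apply: smooth_on_local => p Vp.
have [Kp|nKp] := pselect (K p).
  exists (W `&` V); first by split=> //; exact: KW.
  by apply: smooth_onM => //; [exact: openI | exact: smooth_on_sub sf].
exists (~` K) => //.
apply: smooth_on_eq (smooth_on_cst _ 0); first exact: closed_openC.
by move=> q /f0 ->; rewrite mul0r.
Qed.

(** In a chart the bump is flat(e^2 - |x - x0|^2).  Its support lies in the image of
    a compact coordinate ball, which is closed because the manifold is Hausdorff,
    so that the extension by zero is smooth. *)
Lemma bump W p : open W -> W p ->
  exists f, [/\ smooth_on setT f, forall q, 0 <= f q, 0 < f p &
                supported_in W f].
Proof.
move=> oW Wp; have [a ap] := chart_cover p.
set x0 := chart_map M a p.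
have oI := chart_image_openI (a := a) oW.
have x0I : (chart_map M a @` (chart_dom M a `&` W)) x0 by exists p.
have [e eI] := (nbhs_closedballP _ _).1 (open_nbhs_nbhs (conj oI x0I)).
pose B := closed_ball x0 e%:num; pose K := chart_inv M a @` B.
(* The sup-norm ball of radius e contains the Euclidean one. *)
pose D q := \sum_j (chart_map M a q 0 j - x0 0 j) ^+ 2.
pose h q := flat 0 (e%:num ^+ 2 - D q).
pose f q := if pselect (chart_dom M a q) then h q else 0.
have fE q : chart_dom M a q -> f q = h q by rewrite /f; case: pselect.
have cK : closed K.
  apply: (compact_closed (@point_hausdorff _ _ M)).
  apply: continuous_compact.
    apply: continuous_in_subspaceT => x /[!inE] /eI [q [aq _] <-].
    by apply: chart_inv_continuous; exists q.
  apply: bounded_closed_compact; last exact: closed_ball_closed.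
  rewrite /B closed_ballE// ; exists (`|x0| + e%:num); split; first exact: num_real.
  move=> r r_gt x /=; rewrite /closed_ball_ /= => xe.
  apply: le_trans (ltW r_gt); rewrite -[x](subKr x0).
  by rewrite (le_trans (ler_normB _ _))// lerD2l.
have KW : K `<=` chart_dom M a `&` W.
  by move=> _ [x /eI [q [aq Wq] <-] <-]; rewrite chart_mapK.
have f0 q : ~ K q -> f q = 0.
  move=> nK; rewrite /f; case: pselect => // aq.
  apply: flat_le0; rewrite leNgt subr_gt0; apply/negP => Dlt; apply: nK.
  exists (chart_map M a q); last exact: chart_mapK.
  rewrite /B closed_ballE// /closed_ball_ /= [leLHS]/Num.Def.normr /= mx_normrE.
  apply/bigmax_leP; split=> // -[i j] _; rewrite /= !mxE ord1.
  rewrite -(@ler_pXn2r _ 2)// ?nnegrE// real_normK ?num_real//.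
  apply: le_trans (ltW Dlt); rewrite -sqrrN opprB /D (bigD1 j)//= lerDl.
  by apply: sumr_ge0 => k _; exact: sqr_ge0.
have sh : smooth_on (chart_dom M a) h.
  have oa := @chart_dom_open _ _ M a.
  apply: smooth_on_flat => //.
  apply: (smooth_on_eq oa (f := fun q => e%:num ^+ 2 + (-1) * D q)).
    by move=> q _; rewrite mulN1r.
  apply: smooth_onD => //; first exact: smooth_on_cst.
  apply: smooth_onM => //; first exact: smooth_on_cst.
  apply: smooth_on_sum => // j.
  have sj : smooth_on (chart_dom M a) (fun q => chart_map M a q 0 j + - x0 0 j).
    by apply: smooth_onD => //; [exact: smooth_on_chart | exact: smooth_on_cst].
  by apply: smooth_on_eq (smooth_onM oa sj sj) => // q _; rewrite expr2.
exists f; split.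
- apply: smooth_on_local => q _; have [aq|naq] := pselect (chart_dom M a q).
    exists (chart_dom M a) => //.
    apply: smooth_on_eq sh; first exact: chart_dom_open.
    by move=> r /fE.
  exists (~` K); first by move=> /KW [].
  apply: smooth_on_eq (smooth_on_cst _ 0); first exact: closed_openC.
  by move=> r /f0.
- by move=> q; rewrite /f; case: pselect => ? //; exact: flat_ge0.
- rewrite fE// /h /D big1 ?subr0; first by rewrite flat_gt0// exprn_gt0.
  by move=> j _; rewrite subrr expr0n.
- by exists K => //; split=> // q /KW [].
Qed.

Lemma bump_open f p : smooth_on setT f -> 0 < f p ->
  exists2 V, open V /\ V p & forall q, V q -> f p / 2 < f q.
Proof.
move=> sf f0.
have cf : {for p, continuous f} by exact: smooth_on_continuous openT sf I.
have /cf : nbhs (f p) [set t | f p / 2 < t].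
  by apply: lt_nbhsr; rewrite ltr_pdivrMr// ltr_pMr// ltr1n.
by rewrite /= nbhsE => -[V [oV Vp] Vsub]; exists V.
Qed.

(** Indexing by a countable base: each basic open set on which some bump is
    positive is given one such bump, the others the zero function. *)
Lemma countable_bumps (I : Type) (i0 : I) (U : I -> set M) :
  (forall i, open (U i)) -> (forall p, exists i, U i p) ->
  exists f : nat -> M -> R,
    [/\ forall n, smooth_on setT (f n), forall n q, 0 <= f n q,
        forall n, exists i, supported_in (U i) (f n) &
        forall p, exists n, 0 < f n p].
Proof.
move=> oU Ucov; have [B cB [oB Bb]] := @point_second_countable _ _ M.
pose good (b : set M) f := [/\ smooth_on setT f, forall q, 0 <= f q,
  (exists i, supported_in (U i) f) & forall q, b q -> 0 < f q].
have good0 : exists f, [/\ smooth_on setT f, forall q, 0 <= f q &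
  exists i, supported_in (U i) f].
  exists (fun=> 0); split=> //; first exact: smooth_on_cst.
  by exists i0; exists set0 => //; split=> //; exact: closed0.
have /choice[F HF] : forall b, exists f,
    [/\ smooth_on setT f, forall q, 0 <= f q, exists i, supported_in (U i) f &
     (exists g, good b g) -> forall q, b q -> 0 < f q].
  move=> b; have [[f [? ? ? ?]]|nb] := pselect (exists f, good b f).
    by exists f.
  by have [f [? ? ?]] := good0; exists f; split=> // /nb.
have [e eB] : exists e : nat -> set M, forall b, B b -> exists n, e n = b.
  have /pcard_injP[g ginj] := cB.
  have /choice[e He] : forall n, exists b,
      (exists2 b', B b' & g b' = n) -> B b /\ g b = n.
    move=> n; have [[b Bb' gb]|nb] := pselect (exists2 b', B b' & g b' = n).
      by exists b.
    by exists set0.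
  exists e => b Bb'; exists (g b).
  have [Be ge] := He (g b) (ex_intro2 _ _ b Bb' erefl).
  by apply: ginj; rewrite ?inE.
exists (F \o e); split=> [n|n|n|p] /=; try by case: (HF (e n)).
have [i Ui] := Ucov p; have [f [sf f0 fp suppf]] := bump (oU i) Ui.
have [V [oV Vp] HV] := bump_open sf fp.
have /Bb [b [Bb' bp] bV] := open_nbhs_nbhs (conj oV Vp).
have [n en] := eB b Bb'; exists n; rewrite en.
case: (HF b) => _ _ _; apply=> //; exists f; split=> // [|q /bV/HV].
  by exists i.
by apply: lt_trans; rewrite divr_gt0.
Qed.

(** Multiply f_n by flat(1/(n+1) - f_i) for all i < n.  If f_m p > 0, then near p
    the factor i = m vanishes once 1/(n+1) <= f_m p / 2, whence local finiteness;
    and for the least n with f_n p > 0 all factors are positive at p. *)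
Lemma locally_finite_bumps (I : Type) (i0 : I) (U : I -> set M) :
  (forall i, open (U i)) -> (forall p, exists i, U i p) ->
  exists f : nat -> M -> R,
    [/\ forall n, smooth_on setT (f n), forall n q, 0 <= f n q,
        forall n, exists i, supported_in (U i) (f n),
        forall p, exists n, 0 < f n p &
        forall p, exists N V, [/\ open V, V p &
          forall n q, (N <= n)%N -> V q -> f n q = 0]].
Proof.
move=> oU Ucov.
have [f [sf f0 suppf fpos]] := countable_bumps i0 oU Ucov.
pose w n q := \prod_(i < n) flat 0 (n.+1%:R^-1 - f i q).
exists (fun n q => f n q * w n q); split.
- move=> n; apply: smooth_onM; [exact: openT|exact: sf|].
  apply: smooth_on_prod => [|i]; first exact: openT.
  apply: smooth_on_flat; first exact: openT.
  apply: (smooth_on_eq openT (f := fun q => n.+1%:R^-1 + (-1) * f i q)).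
    by move=> q _; rewrite mulN1r.
  apply: smooth_onD; [exact: openT|exact: smooth_on_cst|].
  by apply: smooth_onM; [exact: openT|exact: smooth_on_cst|].
- move=> n q; rewrite mulr_ge0//; apply: prodr_ge0 => i _; exact: flat_ge0.
- by move=> n; have [i Hi] := suppf n; exists i; exact: supported_inM.
- move=> p; have [n fn nmin] := ex_minnP (fpos p).
  exists n; rewrite mulr_gt0//; apply: prodr_gt0 => i _; apply: flat_gt0.
  have -> : f i p = 0; last by rewrite subr0 invr_gt0.
  apply/eqP; rewrite eq_le f0 andbT leNgt; apply/negP => /nmin.
  by rewrite leqNgt ltn_ord.
- move=> p; have [m fm] := fpos p; have [V [oV Vp] HV] := bump_open (sf m) fm.
  have fm2 : 0 < f m p / 2 by rewrite divr_gt0.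
  pose N := Num.bound (f m p / 2)^-1.
  exists (maxn N m.+1), V; split=> // n q; rewrite geq_max => /andP[Nn mn] Vq.
  rewrite /w (bigD1 (Ordinal mn))//= flat_le0 ?mul0r ?mulr0//.
  rewrite subr_le0; apply: le_trans (ltW (HV q Vq)).
  rewrite invf_ple ?posrE// ?ltr0n//.
  apply: (le_trans (ltW (archi_boundP _))); first by rewrite invr_ge0 ltW.
  by rewrite ler_nat; apply: leq_trans Nn _.
Qed.

End Bumps.

(** * The apolar pairing of binary forms *)

Section Apolar.
Local Open Scope ring_scope.
Variable R : realType.

Definition apolar n : 'M[R]_n.+1 :=
  \matrix_(i, j) ((-1) ^+ i * 'C(n, i)%:R *+ (j == rev_ord i)).

(** The coefficients of (a X1 + b X2)^n. *)
Definition power_form n (a b : R) : 'rV[R]_n.+1 :=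
  \row_i (a ^+ i * b ^+ (n - i)).

Definition col2 (a b : R) : 'cV[R]_2 := \col_i (if i == 0 then a else b).

Lemma poly_fun_eq0 n (c : 'I_n.+1 -> R) :
  (forall t, \sum_(i < n.+1) c i * t ^+ i = 0) -> forall i, c i = 0.
Proof.
move=> c0 i; pose p := \poly_(j < n.+1) c (inord j).
have p0 : p = 0.
  apply: (@roots_geq_poly_eq0 _ _ [seq j%:R | j <- iota 0 n.+1]).
  - apply/allP => t _; apply/rootP; rewrite horner_poly -[RHS](c0 t).
    by apply: eq_bigr => j _; rewrite inord_val.
  - by rewrite map_inj_uniq ?iota_uniq//; exact: mulrIn (oner_neq0 R).
  - by rewrite size_map size_iota size_poly.
have := congr1 (fun q : {poly R} => q`_i) p0.
by rewrite coef_poly ltn_ord inord_val coef0.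
Qed.

Lemma binary_form_inj n (v w : 'rV[R]_n.+1) :
  (forall X, binary_form v X = binary_form w X) -> v = w.
Proof.
move=> vw; apply/rowP => i.
have /(_ i)/eqP : forall i : 'I_n.+1, 'C(n, i)%:R * (v 0 i - w 0 i) = 0.
  apply: poly_fun_eq0 => t; have := vw (col2 t 1); rewrite /binary_form => /eqP.
  rewrite -subr_eq0 -sumrB => /eqP H; rewrite -[RHS]H.
  by apply: eq_bigr => j _; rewrite !mxE /= expr1n; ring.
rewrite mulf_eq0 pnatr_eq0 -leqn0 leqNgt bin_gt0 -ltnS ltn_ord /= subr_eq0.
by move=> /eqP.
Qed.

Lemma binary_formZ n (v : 'rV[R]_n.+1) (c : R) X :
  binary_form v (c *: X) = c ^+ n * binary_form v X.
Proof.
rewrite /binary_form mulr_sumr; apply: eq_bigr => i _; rewrite !mxE !exprMn.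
have -> : c ^+ n = c ^+ i * c ^+ (n - i) by rewrite -exprD subnKC// -ltnS.
ring.
Qed.

Lemma binary_form_power n (a b : R) X :
  binary_form (power_form n a b) X = (a * X 0 0 + b * X 1 0) ^+ n.
Proof.
rewrite addrC exprDn; apply: eq_bigr => i _; rewrite mxE !exprMn -mulr_natr.
ring.
Qed.

Lemma apolar_mulE n (v w : 'rV[R]_n.+1) :
  (v *m apolar n *m w^T) 0 0 =
  \sum_(i < n.+1) (-1) ^+ i * 'C(n, i)%:R * v 0 i * w 0 (rev_ord i).
Proof.
rewrite mxE; under eq_bigr do rewrite !mxE mulr_suml.
rewrite exchange_big; apply: eq_bigr => i _ /=.
rewrite (bigD1 (rev_ord i))//= big1 ?addr0.
  by rewrite !mxE eqxx mulr1n; ring.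
by move=> j /negbTE ji; rewrite mxE ji mulr0n mulr0 mul0r.
Qed.

(** Pairing with the n-th power of a X1 + b X2 is evaluation at its zero (b, -a). *)
Lemma apolar_power n (a b : R) (w : 'rV[R]_n.+1) :
  (power_form n a b *m apolar n *m w^T) 0 0 = binary_form w (col2 b (- a)).
Proof.
rewrite apolar_mulE (reindex_inj rev_ord_inj); apply: eq_bigr => i _.
have le_in : (i <= n)%N by rewrite -ltnS.
rewrite rev_ordK !mxE /= subSS subKn// bin_sub//.
by rewrite [in RHS]exprNn; ring.
Qed.

Lemma det_mx2 (G : 'M[R]_2) : \det G = G 0 0 * G 1 1 - G 0 1 * G 1 0.
Proof.
rewrite (expand_det_row _ 0) !big_ord_recl big_ord0 /cofactor !det_mx11 !mxE /=.
have -> : lift 0 (0 : 'I_1) = 1 by exact/val_inj.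
have -> : lift 1 (0 : 'I_1) = 0 by exact/val_inj.
by rewrite addn0 expr0 expr1; ring.
Qed.

(** Substituting G turns the n-th power of the linear form l into that of l G, whose
    zero is mapped by G to det G times the zero of l.  So both sides agree when
    paired with powers of linear forms, and these span. *)
Lemma apolar_equivariant n (A : 'M[R]_n.+1) (G : 'M[R]_2) :
  (forall v X, binary_form (v *m A) X = binary_form v (G *m X)) ->
  A *m apolar n *m A^T = \det G ^+ n *: apolar n.
Proof.
move=> AG.
pose ga a b := a * G 0 0 + b * G 1 0; pose gb a b := a * G 0 1 + b * G 1 1.
have GX (X : 'cV[R]_2) i : (G *m X) i 0 = G i 0 * X 0 0 + G i 1 * X 1 0.
  rewrite mxE !big_ord_recl big_ord0 addr0.
  by congr (_ * _ + G _ _ * X _ _); exact/val_inj.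
have powA a b : power_form n a b *m A = power_form n (ga a b) (gb a b).
  apply: binary_form_inj => X; rewrite AG !binary_form_power !GX /ga /gb.
  by congr (_ ^+ _); ring.
have GJ a b : G *m col2 (gb a b) (- ga a b) = \det G *: col2 b (- a).
  apply/colP => i; rewrite GX det_mx2 /ga /gb.
  have [->|->] : i = 0 \/ i = 1.
    by case: i => -[|[|//]] ilt; [left | right]; exact/val_inj.
  - by rewrite !mxE /=; ring.
  - by rewrite !mxE /=; ring.
have key a b (w : 'rV[R]_n.+1) :
    (power_form n a b *m (A *m apolar n *m A^T - \det G ^+ n *: apolar n)
       *m w^T) 0 0 = 0.
  rewrite mulmxBr mulmxBl mxE [X in _ + X]mxE.
  have -> : power_form n a b *m (A *m apolar n *m A^T) *m w^T
      = power_form n (ga a b) (gb a b) *m apolar n *m (w *m A)^T.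
    by rewrite -powA trmx_mul !mulmxA.
  rewrite -scalemxAr -scalemxAl [X in _ - X]mxE !apolar_power AG GJ binary_formZ.
  by rewrite subrr.
apply/eqP; rewrite -subr_eq0; apply/eqP/matrixP => i j; rewrite [RHS]mxE.
move: (_ - _) key => D key.
(* The powers of t X1 + X2, t varying, already span. *)
apply: (@poly_fun_eq0 n (fun i => D i j)) => t.
rewrite -[RHS](key t 1 (delta_mx 0 j)) trmx_delta -colE mxE [RHS]mxE.
by apply: eq_bigr => l _; rewrite !mxE expr1n mulr1 mulrC.
Qed.

Lemma I0_apolar k (v : 'rV[R]_(2 * k).+1) :
  I0 v = (v *m apolar (2 * k) *m v^T) 0 0.
Proof.
rewrite apolar_mulE /I0.
pose F i := (-1) ^+ i * 'C(2 * k, i)%:R * v 0 (inord i) * v 0 (inord (2 * k - i)).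
transitivity (\sum_(0 <= i < (2 * k).+1) F i); last first.
  rewrite big_mkord; apply: eq_bigr => i _; rewrite /F inord_val.
  by congr (_ * v 0 _); apply/val_inj; rewrite /= inordK ?subSS// ltnS leq_subr.
rewrite (@big_cat_nat _ _ _ k)//=; last by lia.
rewrite [X in _ = _ + X]big_ltn; last by lia.
(* The terms i and 2k - i coincide, as 2k is even. *)
have -> : \sum_(k.+1 <= i < (2 * k).+1) F i = \sum_(0 <= i < k) F i.
  rewrite -{1}[k.+1]add0n big_addn.
  have -> : ((2 * k).+1 - k.+1 = k)%N by lia.
  rewrite big_nat_rev /= !big_nat; apply: eq_bigr => i /andP[_ ik].
  have -> : (0 + k - i.+1 + k.+1 = 2 * k - i)%N by lia.
  rewrite /F (_ : (2 * k - (2 * k - i))%N = i); last by lia.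
  rewrite bin_sub; last by lia.
  rewrite -signr_odd oddB; last by lia.
  by rewrite oddM /= signr_odd; ring.
rewrite big_mkord /F (_ : (2 * k - k)%N = k); last by lia.
by ring.
Qed.

End Apolar.

(** * Signatures and null cones *)

Section Signature.
Local Open Scope ring_scope.
Variable R : realType.

Lemma mx_signature_congr d p q (A Q : 'M[R]_d) (c : R) : 0 < c ->
  Q \in unitmx -> mx_signature p q A -> mx_signature p q (c *: (Q *m A *m Q^T)).
Proof.
move=> c0 uQ [pqd [P uP PA]]; split=> //.
have s0 : Num.sqrt c != 0 by rewrite gt_eqF// sqrtr_gt0.
exists ((Num.sqrt c)^-1 *: (P *m invmx Q)).
  by rewrite unitmxZ ?unitfE ?invr_eq0// unitmx_mul uP unitmx_inv.
rewrite (_ : (_ *: (P *m invmx Q))^T = (Num.sqrt c)^-1 *: (P *m invmx Q)^T);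
  last by rewrite linearZ.
rewrite trmx_mul trmx_inv -!scalemxAl -!scalemxAr -!scalemxAl !scalerA.
have -> : (Num.sqrt c)^-1 * ((Num.sqrt c)^-1 * c) = 1.
  by rewrite -{3}(sqr_sqrtr (ltW c0)) expr2 mulKf// mulVf.
rewrite scale1r -PA !mulmxA mulmxKV//; congr (_ *m _).
by rewrite -!mulmxA mulmxV ?unitmx_tr// mulmx1.
Qed.

(** The sign of the determinant is a congruence invariant. *)
Lemma mx_signature_det d p q (A : 'M[R]_d) :
  mx_signature p q A -> 0 < (-1) ^+ q * \det A.
Proof.
move=> [pqd [P uP /(congr1 determinant)]].
rewrite !det_mulmx det_tr det_diag.
have -> : \prod_(i < d) (\row_(i < d) (if (i < p)%N then 1 else -1 : R)) 0 i
    = (-1) ^+ q.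
  subst d; rewrite big_split_ord /= big1 ?mul1r.
    rewrite (eq_bigr (fun=> -1)) ?prodr_const ?card_ord// => i _.
    by rewrite mxE /= ltnNge leq_addr.
  by move=> i _; rewrite mxE /= ltn_ord.
move=> detE; rewrite -detE (_ : _ * _ = (\det P * \det A) ^+ 2); last by ring.
have P0 : \det P != 0 by rewrite -unitfE -unitmxE.
rewrite lt0r sqr_ge0 sqrf_eq0 mulf_neq0//.
apply/eqP => A0; move: detE; rewrite A0 mulr0 mul0r => /esym/eqP.
by rewrite signr_eq0.
Qed.

(** In odd dimension a negative factor reverses the sign of the determinant. *)
Lemma mx_signature_scale d p q (A : 'M[R]_d) (c : R) : odd d ->
  mx_signature p q A -> mx_signature p q (c *: A) -> 0 < c.
Proof.
move=> od /mx_signature_det A0 /mx_signature_det; rewrite detZ mulrCA pmulr_lgt0//.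
move=> cd; have c0 : c != 0.
  apply: contraTneq cd => ->; rewrite expr0n.
  by case: (d) od => // m _; rewrite ltxx.
move: cd; rewrite -[d]odd_double_half od add1n exprS -mul2n exprM pmulr_lgt0//.
by rewrite exprn_gt0// lt0r sqr_ge0 sqrf_eq0 c0.
Qed.

End Signature.

Section ApolarCone.
Local Open Scope ring_scope.
Variables (R : realType) (k : nat).
Let n := (2 * k)%N.
Let b (i : 'I_n.+1) : R := (-1) ^+ i * 'C(n, i)%:R.
Let mid : 'I_n.+1 := inord k.

Let val_mid : mid = k :> nat.
Proof. by rewrite inordK//; lia. Qed.

Let rev_mid : rev_ord mid = mid.
Proof. by apply/val_inj; rewrite /= val_mid; lia. Qed.

Let rev_neq i : i != mid -> rev_ord i != i.
Proof.
apply: contraNneq => /(congr1 val) /= H; apply/eqP/val_inj; rewrite /= val_mid.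
by have := ltn_ord i; lia.
Qed.

Let b_rev i : b (rev_ord i) = b i.
Proof.
rewrite /b /= subSS; have ilt : (i <= n)%N by rewrite -ltnS.
by rewrite bin_sub// -signr_odd oddB// /n oddM /= signr_odd.
Qed.

Let b_neq0 i : b i != 0.
Proof.
by rewrite mulf_neq0 ?signr_eq0// pnatr_eq0 -lt0n bin_gt0 -ltnS.
Qed.

Let apolarE i j : apolar R n i j = if j == rev_ord i then b i else 0.
Proof. by rewrite mxE; case: eqP. Qed.

Lemma apolar_tr : (apolar R n)^T = apolar R n.
Proof.
apply/matrixP => i j.
rewrite mxE !apolarE [i == _]eq_sym (can2_eq rev_ordK rev_ordK).
by case: eqP => // ->; rewrite b_rev.
Qed.

Definition apolar_pos := if odd k then k else k.+1.
Definition apolar_neg := if odd k then k.+1 else k.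

(** For i < k the vectors e_i + c_i e_(n-i) and e_i - c_i e_(n-i), c_i = 1/(2 b_i),
    are orthogonal, with squares 1 and -1.  Listing them at the places i and n - i, with
    the middle vector between, puts the signs in the required order whatever the
    parity of k. *)
Lemma apolar_signature : mx_signature apolar_pos apolar_neg (apolar R n).
Proof.
split; first by rewrite /apolar_pos /apolar_neg /n; case: odd; lia.
pose c i : R := (2 * b i)^-1.
pose al (i : 'I_n.+1) := if (i < k)%N then 1 else
  if i == mid then (Num.sqrt 'C(n, k)%:R)^-1 else - c i.
pose be (i : 'I_n.+1) := if (i < k)%N then c i else
  if i == mid then 0 else 1.
(* Row i of P is al i * e_i + be i * e_(n-i). *)
pose P : 'M[R]_n.+1 := \matrix_(i, j) (al i *+ (j == i) + be i *+ (j == rev_ord i)).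
have PA i j : (P *m apolar R n) i j = b j * P i (rev_ord j).
  rewrite mxE (bigD1 (rev_ord j))//= big1 ?addr0.
    by rewrite apolarE rev_ordK eqxx b_rev mulrC.
  move=> l lj; rewrite apolarE ifN ?mulr0//.
  by apply: contraNneq lj => ->; rewrite rev_ordK.
have PAP i j : (P *m apolar R n *m P^T) i j =
    b i * (al i * (al j *+ (j == rev_ord i) + be j *+ (j == i))
       + be i * (al j *+ (j == i) + be j *+ (j == rev_ord i))).
  rewrite mxE.
  under eq_bigr => l _.
    rewrite PA [in X in X * _]mxE [P^T _ _]mxE (can2_eq rev_ordK rev_ordK).
    rewrite (inj_eq rev_ord_inj) mulrDr mulrDl.
    over.
  rewrite big_split /= (bigD1 (rev_ord i))//= [X in _ + X](bigD1 i)//= !eqxx.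
  rewrite !big1 ?addr0; first last.
  - by move=> l /negbTE ->; rewrite mulr0n mulr0 mul0r.
  - by move=> l /negbTE ->; rewrite mulr0n mulr0 mul0r.
  rewrite b_rev !mxE (inj_eq rev_ord_inj) ![_ == j]eq_sym.
  rewrite [i == rev_ord j]eq_sym (can2_eq rev_ordK rev_ordK) !mulr1n.
  by rewrite [RHS]mulrDr !mulrA.
have D : P *m apolar R n *m P^T =
   diag_mx (\row_(i < n.+1) (if (i < apolar_pos)%N then 1 else -1)).
  have c_rev i : c (rev_ord i) = c i by rewrite /c b_rev.
  have bc i : b i * c i = 2^-1 by rewrite /c invfM mulrC mulfVK.
  have bin0 : 0 < 'C(n, k)%:R :> R by rewrite ltr0n bin_gt0; lia.
  apply/matrixP => i j; rewrite PAP !mxE [i == j]eq_sym.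
  have [->|imid] := eqVneq i mid.
    rewrite rev_mid; have [->|_] := eqVneq j mid; last first.
      by rewrite !mulr0n !addr0 !mulr0 addr0 mulr0.
    rewrite !mulr1n /al /be val_mid ltnn eqxx addr0 mul0r addr0 -expr2 exprVn.
    rewrite sqr_sqrtr ?ltW// /b val_mid mulfK ?gt_eqF// -signr_odd.
    by rewrite /apolar_pos; case: odd; rewrite ?ltnn ?ltnSn.
  have /= ri := rev_neq imid.
  have iltn := ltn_ord i.
  have imk : (i : nat) != k.
    by apply: contraNneq imid => ik; apply/eqP/val_inj; rewrite /= val_mid.
  have ripos : (rev_ord i < k)%N = ~~ (i < k)%N by rewrite /=; lia.
  have rimid : rev_ord i == mid = false.
    by apply/negbTE; rewrite (can2_eq rev_ordK rev_ordK) rev_mid.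
  have pos_i : (i < apolar_pos)%N = (i < k)%N.
    by rewrite /apolar_pos; case: odd; lia.
  rewrite pos_i; have [->|ji] := eqVneq j i.
    rewrite eq_sym (negbTE ri) !mulr0n !mulr1n add0r addr0 [be i * _]mulrC.
    rewrite -mulr2n -mulr_natl /al /be (negbTE imid).
    by case: (i < k)%N; rewrite ?mul1r ?mulr1 ?mulrN mulrCA bc mulfV.
  rewrite !mulr0n addr0 add0r; have [->|_] := eqVneq j (rev_ord i); last first.
    by rewrite !mulr0n !mulr0 addr0 mulr0.
  rewrite !mulr1n /al /be ripos rimid (negbTE imid) c_rev.
  by case: (i < k)%N => /=; ring.
exists P => //.
have : \det (P *m apolar R n *m P^T) != 0.
  rewrite D det_diag; apply/prodf_neq0 => i _; rewrite mxE.
  by case: ifP; rewrite ?oner_neq0 ?oppr_eq0 ?oner_neq0.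
by rewrite !det_mulmx !mulf_eq0 !negb_or unitmxE unitfE => /andP[/andP[]].
Qed.

Lemma apolar_unit : apolar R n \in unitmx.
Proof.
rewrite unitmxE unitfE; have := mx_signature_det apolar_signature.
by apply: contraTneq => ->; rewrite mulr0 ltxx.
Qed.

Lemma quad3 (S : 'M[R]_n.+1) (h i j : 'I_n.+1) (x y z : R) : S^T = S ->
  let w := x *: delta_mx 0 h + y *: delta_mx 0 i + z *: delta_mx 0 j : 'rV_n.+1 in
  (w *m S *m w^T) 0 0 = x ^+ 2 * S h h + y ^+ 2 * S i i + z ^+ 2 * S j j
    + 2 * x * y * S h i + 2 * x * z * S h j + 2 * y * z * S i j.
Proof.
move=> St w.
have Sc l m : S l m = S m l by rewrite -{1}St mxE.
pose f (u v : 'rV[R]_n.+1) : R := (u *m S *m v^T) 0 0.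
have fdelta l m : f (delta_mx 0 l) (delta_mx 0 m) = S l m.
  by rewrite /f -rowE trmx_delta -colE !mxE.
have fDl u v u' : f (u + v) u' = f u u' + f v u' by rewrite /f !mulmxDl mxE.
have fDr u v u' : f u' (u + v) = f u' u + f u' v.
  by rewrite /f linearD mulmxDr mxE.
have fZl c u v : f (c *: u) v = c * f u v by rewrite /f -!scalemxAl mxE.
have fZr c u v : f u (c *: v) = c * f u v by rewrite /f linearZ /= -scalemxAr mxE.
rewrite -/(f w w) /w !(fDl, fDr, fZl, fZr) !fdelta.
by rewrite (Sc i h) (Sc j h) (Sc j i); ring.
Qed.

(** Testing S on the null vectors x e_i + y e_j with j <> n - i kills all entries off
    the antidiagonal and away from the middle.  Testing it on the null vectors
    x e_i + y e_(n-i) + e_mid, where x y is a fixed nonzero number, kills the rest of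
    the middle row and ties the entry (i, n-i) to the middle one. *)
Lemma apolar_cone (S : 'M[R]_n.+1) : S^T = S ->
  (forall w : 'rV[R]_n.+1,
    (w *m apolar R n *m w^T) 0 0 = 0 -> (w *m S *m w^T) 0 0 = 0) ->
  exists c, S = c *: apolar R n.
Proof.
move=> St cone.
pose Q h i j x y z := quad3 h i j x y z St.
pose Q0 h i j x y z := quad3 h i j x y z apolar_tr.
have apolar_off i j : j != rev_ord i -> apolar R n i j = 0.
  by move=> ij; rewrite apolarE (negbTE ij).
have apolar_diag i : i != mid -> apolar R n i i = 0.
  by move=> /rev_neq ij; rewrite apolar_off// eq_sym.
have S_off i j : i != mid -> j != mid -> j != rev_ord i -> S i j = 0.
  move=> im jm ij.
  have null x y : x ^+ 2 * S i i + y ^+ 2 * S j j + 2 * x * y * S i j = 0.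
    rewrite -(cone (x *: delta_mx 0 i + y *: delta_mx 0 j + 0 *: delta_mx 0 i)).
      by rewrite Q; ring.
    by rewrite Q0 !apolar_diag// (apolar_off i j)//; ring.
  by have := null 1 0; have := null 0 1; have := null 1 1; lra.
have S_pair i : i != mid ->
    [/\ S i mid = 0, S (rev_ord i) mid = 0 &
        S i (rev_ord i) = S mid mid / b mid * b i].
  move=> im; set j := rev_ord i.
  have jm : j != mid by rewrite (can2_eq rev_ordK rev_ordK) rev_mid.
  have Sii : S i i = 0 by apply: S_off => //; rewrite eq_sym; exact: rev_neq.
  have Sjj : S j j = 0 by apply: S_off => //; rewrite eq_sym; exact: rev_neq.
  have null x y : 2 * x * y * b i + b mid = 0 ->
      S mid mid + 2 * x * y * S i j + 2 * x * S i mid + 2 * y * S j mid = 0.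
    move=> xy.
    rewrite -(cone (x *: delta_mx 0 i + y *: delta_mx 0 j + 1 *: delta_mx 0 mid)).
      by rewrite Q Sii Sjj; ring.
    rewrite Q0 (apolar_diag i im) (apolar_diag j jm).
    rewrite (apolar_off i mid) 1?eq_sym// (apolar_off j mid) ?rev_ordK 1?eq_sym//.
    rewrite !apolarE rev_mid !eqxx.
    by rewrite -[RHS]xy; ring.
  set u := S i mid; set v := S j mid.
  (* The vector is null when x y = m; three points of this hyperbola suffice. *)
  pose m := - b mid / (2 * b i).
  have mE : 2 * m * b i + b mid = 0 by rewrite /m; field; exact: b_neq0.
  have m0 : m != 0.
    apply: mulf_neq0; first by rewrite oppr_eq0; exact: b_neq0.
    by rewrite invr_eq0; apply: mulf_neq0; [rewrite pnatr_eq0 | exact: b_neq0].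
  have := null m 1; have := null (- m) (-1); have := null (2 * m) 2^-1.
  rewrite -/u -/v.
  have -> : 2 * (2 * m) / 2 * b i + b mid = 2 * m * b i + b mid by field.
  have -> : 2 * - m * -1 * b i + b mid = 2 * m * b i + b mid by ring.
  rewrite !mulr1 mE => /(_ erefl) e1 /(_ erefl) e2 /(_ erefl) e3.
  have v0 : v = 0 by lra.
  have mu0 : m * u = 0 by lra.
  have u0 : u = 0 by move/eqP: mu0; rewrite mulf_eq0 (negbTE m0) => /eqP.
  split=> //.
  have : 2 * m * S i j = - S mid mid by lra.
  move=> H; have -> : S mid mid = - (2 * m * S i j) by rewrite H opprK.
  by rewrite /m; field; rewrite !b_neq0.
exists (S mid mid / b mid); apply/matrixP => i j; rewrite mxE apolarE.
have Sc l m : S l m = S m l by rewrite -{1}St mxE.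
have [->|im] := eqVneq i mid.
  rewrite rev_mid; have [->|jm] := eqVneq j mid; first by rewrite mulfVK.
  by have [Sjm _ _] := S_pair j jm; rewrite Sc Sjm mulr0.
have [Sim _ Sij] := S_pair i im.
have [->|ij] := eqVneq j (rev_ord i); first exact: Sij.
rewrite mulr0; have [->|jm] := eqVneq j mid; first exact: Sim.
exact: S_off.
Qed.

End ApolarCone.

(** * Conformal classes of metrics *)

Section Conformal.
Local Open Scope classical_set_scope.
Local Open Scope ring_scope.
Variables (R : realType) (d : nat) (M : manifold R d.+1).
Implicit Types g h : metric M.

(** A factor found pointwise is automatically smooth, being the normalised trace of
    h g^-1 in every chart. *)
Lemma conformalI g h :
  (forall p, exists2 c, 0 < c &
     forall a, chart_dom M a p -> metric_comp h a p = c *: metric_comp g a p) ->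
  conformal g h.
Proof.
move=> H; have /choice[f Hf] : forall p, exists c, 0 < c /\
    forall a, chart_dom M a p -> metric_comp h a p = c *: metric_comp g a p.
  by move=> p; have [c c0 hc] := H p; exists c.
exists f; split;
  [|by move=> p; case: (Hf p)|by move=> a p; case: (Hf p) => _; apply].
apply: smooth_on_local => p _; have [a ap] := chart_cover p.
exists (chart_dom M a) => //; have oa := @chart_dom_open _ _ M a.
have sg : smooth_mx (chart_dom M a) (metric_comp g a) by exact: metric_smooth.
have sh : smooth_mx (chart_dom M a) (metric_comp h a) by exact: metric_smooth.
have sT := smooth_mxM oa sh (smooth_mx_inv oa (metric_nondegenerate g (a := a)) sg).
apply: smooth_on_eq (smooth_onM oa (smooth_on_cst _ (d.+1%:R^-1))
  (smooth_on_sum (index_enum _) predT oa (fun i => sT i i))) => // q aq.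
rewrite -[X in _ * X]/(\tr (metric_comp h a q *m invmx (metric_comp g a q))).
rewrite (Hf q).2// -scalemxAl mulmxV ?metric_nondegenerate// mxtraceZ mxtrace1.
by rewrite mulrCA mulVf ?mulr1// pnatr_eq0.
Qed.

Lemma conformal_refl g : conformal g g.
Proof. by apply: conformalI => p; exists 1 => // a _; rewrite scale1r. Qed.

Lemma conformal_sym g h : conformal g h -> conformal h g.
Proof.
move=> [f [_ f0 fgh]]; apply: conformalI => p; exists (f p)^-1.
  by rewrite invr_gt0.
by move=> a /fgh ->; rewrite scalerA mulVf ?scale1r// gt_eqF.
Qed.

Lemma conformal_trans g h l : conformal g h -> conformal h l -> conformal g l.
Proof.
move=> [f [_ f0 fgh]] [f' [_ f'0 fhl]]; apply: conformalI => p.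
exists (f' p * f p); first by rewrite mulr_gt0.
by move=> a ap; rewrite fhl// fgh// scalerA.
Qed.

Lemma conformal_eq g h : conformal g h -> conformal g = conformal h.
Proof.
move=> gh; apply/funext => l; apply/propext; split.
  exact: conformal_trans (conformal_sym gh).
exact: conformal_trans.
Qed.

Lemma conf_class_inj : injective (@conf_class R d.+1 M).
Proof.
move=> [C HC] [D HD] /= CD; subst D; congr ConformalStructure.
exact: Prop_irrelevance.
Qed.

End Conformal.

(** * The conformal structure of a GL(2)-structure *)

Section GL2.
Local Open Scope classical_set_scope.
Local Open Scope ring_scope.
Variables (R : realType) (k : nat) (M : manifold R (2 * k).+1).
Variable G : GL2_structure M.
Let n := (2 * k)%N.

Definition local_metric (s : triv (spinor G)) (a : chart M) (p : M) : 'M[R]_n.+1 :=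
  theta s a p *m apolar R n *m (theta s a p)^T.

Lemma I0_local_metric (s : triv (spinor G)) (a : chart M) (p : M)
    (v : 'rV[R]_n.+1) :
  I0 (v *m theta s a p) = (v *m local_metric s a p *m v^T) 0 0.
Proof. by rewrite I0_apolar trmx_mul !mulmxA. Qed.

(** The factor is the n-th power of the determinant of the spinor transition, which
    is positive because n is even. *)
Lemma local_metric_triv s t a p :
  triv_dom (spinor G) s p -> triv_dom (spinor G) t p -> chart_dom M a p ->
  exists2 c, 0 < c & local_metric t a p = c *: local_metric s a p.
Proof.
move=> sp tp ap; set D := vb_trans (spinor G) s t p.
have D0 : \det D != 0.
  have : \det (D *m vb_trans (spinor G) t s p) = 1.
    by rewrite vb_trans_cocycle// vb_trans_id// det1.
  rewrite det_mulmx => /eqP; apply: contraTneq => ->.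
  by rewrite mul0r eq_sym oner_neq0.
exists (\det D ^+ n); first by rewrite exprM exprn_gt0// lt0r sqr_ge0 sqrf_eq0 D0.
have us := theta_iso sp ap.
pose A := invmx (theta s a p) *m theta t a p.
have AD v X : binary_form (v *m A) X = binary_form v (D *m X).
  by rewrite mulmxA (theta_triv sp tp ap) mulmxKV.
have E := apolar_equivariant AD.
have -> : local_metric t a p =
    theta s a p *m (A *m apolar R n *m A^T) *m (theta s a p)^T.
  rewrite /local_metric /A trmx_mul !mulmxA mulmxV// mul1mx.
  by rewrite -!mulmxA trmx_inv mulVmx ?mulmx1// unitmx_tr.
by rewrite E -scalemxAr -scalemxAl.
Qed.

Lemma local_metric_chart s a b p :
  triv_dom (spinor G) s p -> chart_dom M a p -> chart_dom M b p ->
  local_metric s a p =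
  tangent_trans a b p *m local_metric s b p *m (tangent_trans a b p)^T.
Proof.
by move=> sp ap bp; rewrite /local_metric (theta_chart sp ap bp) trmx_mul !mulmxA.
Qed.

Lemma local_metric_smooth s a :
  smooth_mx (triv_dom (spinor G) s `&` chart_dom M a) (local_metric s a).
Proof.
have oW := openI (@triv_dom_open _ _ _ _ (spinor G) s) (@chart_dom_open _ _ M a).
have sth : smooth_mx (triv_dom (spinor G) s `&` chart_dom M a) (theta s a).
  exact: theta_smooth.
apply: smooth_mxM => //; last exact: smooth_mx_tr.
by apply: smooth_mxM => //; exact: smooth_mx_cst.
Qed.

Lemma local_metric_tr s a p : (local_metric s a p)^T = local_metric s a p.
Proof. by rewrite !trmx_mul trmxK apolar_tr mulmxA. Qed.

Lemma local_metric_unit s a p : triv_dom (spinor G) s p -> chart_dom M a p ->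
  local_metric s a p \in unitmx.
Proof.
by move=> sp ap; rewrite !unitmx_mul unitmx_tr apolar_unit (theta_iso sp ap).
Qed.

(** The index None, with empty domain, provides a default index for the terms that
    vanish identically, also when there is no trivialisation at all. *)
Definition triv_cover_dom (o : option (triv (spinor G))) : set M :=
  if o is Some s then triv_dom (spinor G) s else set0.

(** Weighted sum of the local metrics: at each point all of its terms are nonnegative
    multiples of any given local metric, and one multiple is positive. *)
Lemma exists_global_metric : exists g : metric M, forall s a p,
  triv_dom (spinor G) s p -> chart_dom M a p ->
  exists2 c, 0 < c & metric_comp g a p = c *: local_metric s a p.
Proof.
have oU o : open (triv_cover_dom o).
  by case: o => [s|]; [exact: triv_dom_open | exact: open0].
have Ucov p : exists o, triv_cover_dom o p.
  by have [s sp] := triv_cover (spinor G) p; exists (Some s).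
have [f [sf f0 suppf fpos flf]] := locally_finite_bumps None oU Ucov.
have /choice[idx Hidx] := suppf.
have /choice[N HN] : forall p, exists N, forall m, (N <= m)%N -> f m p = 0.
  by move=> p; have [N [V [_ Vp HV]]] := flf p; exists N => m /HV; apply.
pose term m a p := if idx m is Some s then f m p *: local_metric s a p else 0.
have term0 m a p : f m p = 0 -> term m a p = 0.
  by rewrite /term => ->; case: (idx m) => // s; rewrite scale0r.
pose g a p := \sum_(m < N p) term m a p.
(* The bound N p can be replaced by one valid in a whole neighbourhood. *)
have gE K a p : (forall m, (K <= m)%N -> f m p = 0) ->
    g a p = \sum_(m < K) term m a p.
  have aux (K1 K2 : nat) : (forall m, (K1 <= m)%N -> f m p = 0) -> (K1 <= K2)%N ->
      \sum_(m < K1) term m a p = \sum_(m < K2) term m a p.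
    move=> H K12; rewrite -!(big_mkord predT (fun m => term m a p)).
    rewrite [RHS](big_cat_nat (leq0n K1) K12) /= [X in _ = _ + X]big1_seq ?addr0//.
    by move=> m; rewrite mem_index_iota => /= /andP[K1m _]; rewrite term0// H.
  move=> HK; have [NK|/ltnW KN] := leqP (N p) K; first exact: aux (HN p) NK.
  exact/esym/aux.
have term_scale m s a p : triv_dom (spinor G) s p -> chart_dom M a p ->
    exists2 c, 0 <= c /\ (0 < f m p -> 0 < c) &
      term m a p = c *: local_metric s a p.
  move=> sp ap; have [fm0|fm0] := eqVneq (f m p) 0.
    by exists 0; [rewrite fm0 ltxx | rewrite term0// scale0r].
  have : triv_cover_dom (idx m) p.
    by apply: contrapT => /(supported_in_off (Hidx m)) /eqP; rewrite (negbTE fm0).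
  rewrite /term; case: (idx m) => //= t tp.
  have [c c0 ->] := local_metric_triv sp tp ap.
  have fmp : 0 < f m p by rewrite lt0r fm0 f0.
  exists (f m p * c); last by rewrite scalerA.
  by split=> [|_]; rewrite ?mulr_gt0// ltW ?mulr_gt0.
have g_scale s a p : triv_dom (spinor G) s p -> chart_dom M a p ->
    exists2 c, 0 < c & g a p = c *: local_metric s a p.
  move=> sp ap.
  have /choice[c Hc] : forall m, exists c, (0 <= c /\ (0 < f m p -> 0 < c)) /\
      term m a p = c *: local_metric s a p.
    by move=> m; have [c ? ?] := term_scale m s a p sp ap; exists c.
  exists (\sum_(m < N p) c m); last first.
    by rewrite scaler_suml; apply: eq_bigr => m _; rewrite (Hc m).2.
  have [m fm] := fpos p.
  have mN : (m < N p)%N.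
    by rewrite ltnNge; apply/negP => /HN fm0; rewrite fm0 ltxx in fm.
  rewrite (bigD1 (Ordinal mN))//= ltr_pwDl//; first exact: (Hc m).1.2 fm.
  by apply: sumr_ge0 => l _; exact: (Hc l).1.1.
have term_chart m a b p : chart_dom M a p -> chart_dom M b p ->
    term m a p = tangent_trans a b p *m term m b p *m (tangent_trans a b p)^T.
  move=> ap bp; have [fm0|fm0] := eqVneq (f m p) 0.
    by rewrite !term0// mulmx0 mul0mx.
  have : triv_cover_dom (idx m) p.
    by apply: contrapT => /(supported_in_off (Hidx m)) /eqP; rewrite (negbTE fm0).
  rewrite /term; case: (idx m) => //= t tp.
  by rewrite -scalemxAr -scalemxAl -local_metric_chart.
have term_smooth m a : smooth_mx (chart_dom M a) (term m a).
  have oa := @chart_dom_open _ _ M a; have supp := Hidx m.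
  rewrite /term; case: (idx m) supp => [t|] supp /=; last exact: smooth_mx_cst.
  move=> i j.
  have H := smooth_on_supported oa (oU (Some t)) supp (sf m)
    (local_metric_smooth t a i j).
  by apply: smooth_on_eq H => // p _; rewrite [RHS]mxE.
have g_smooth a i j : smooth_on (chart_dom M a) (fun p => g a p i j).
  have oa := @chart_dom_open _ _ M a.
  apply: smooth_on_local => p ap; have [K [V [oV Vp HV]]] := flf p.
  exists (V `&` chart_dom M a) => //.
  have oVa := openI oV oa.
  apply: (@smooth_on_eq _ _ _ _ (fun q => \sum_(m < K) term m a q i j)) => //.
    by move=> q [Vq _]; rewrite (gE K) ?summxE// => m Km; exact: HV.
  apply: smooth_on_sum => // m; apply: smooth_on_sub (term_smooth m a i j).
  by move=> q [].
have g_sym a p : chart_dom M a p -> (g a p)^T = g a p.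
  move=> ap; have [s sp] := triv_cover (spinor G) p.
  by have [c _ ->] := g_scale s a p sp ap; rewrite linearZ /= local_metric_tr.
have g_unit a p : chart_dom M a p -> g a p \in unitmx.
  move=> ap; have [s sp] := triv_cover (spinor G) p.
  have [c c0 ->] := g_scale s a p sp ap.
  by rewrite unitmxZ ?unitfE ?gt_eqF// local_metric_unit.
have g_trans a b p : chart_dom M a p -> chart_dom M b p ->
    g a p = tangent_trans a b p *m g b p *m (tangent_trans a b p)^T.
  move=> ap bp; rewrite /g mulmx_sumr mulmx_suml.
  by apply: eq_bigr => m _; exact: term_chart.
by exists (@Defs.Metric R _ M g g_smooth g_sym g_unit g_trans).
Qed.

Lemma I0_scale (c : R) (v : 'rV[R]_n.+1) : I0 (c *: v) = c ^+ 2 * I0 v.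
Proof.
rewrite !I0_apolar linearZ /= -scalemxAr -!scalemxAl scalerA mxE.
by rewrite expr2.
Qed.

Lemma I0_triv s t a p (v : 'rV[R]_n.+1) :
  triv_dom (spinor G) s p -> triv_dom (spinor G) t p -> chart_dom M a p ->
  I0 (v *m theta s a p) = 0 -> I0 (v *m theta t a p) = 0.
Proof.
move=> sp tp ap; rewrite !I0_local_metric => v0.
have [c _ ->] := local_metric_triv sp tp ap.
by rewrite -scalemxAr -scalemxAl mxE v0 mulr0.
Qed.

(** The field has constant coefficients w in the frame dual to theta, multiplied by a
    bump supported in the domain of the trivialisation. *)
Lemma null_field_through s p (w : 'rV[R]_n.+1) :
  triv_dom (spinor G) s p -> I0 w = 0 ->
  exists V : vector_field M, I0_vanishes G V /\
    exists2 c, 0 < c & forall a, vf_comp V a p = c *: (w *m invmx (theta s a p)).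
Proof.
move=> sp w0.
have os := @triv_dom_open _ _ _ _ (spinor G) s.
have [f [sf f0 fp supp]] := bump os sp.
pose v a q := f q *: (w *m invmx (theta s a q)).
have v_smooth a j : smooth_on (chart_dom M a) (fun q => v a q 0 j).
  have oa := @chart_dom_open _ _ M a; have oI := openI os oa.
  have sI : smooth_mx (triv_dom (spinor G) s `&` chart_dom M a)
      (fun q => w *m invmx (theta s a q)).
    apply: smooth_mxM => //; first exact: smooth_mx_cst.
    apply: smooth_mx_inv => // [q [sq aq]|]; first exact: theta_iso.
    exact: theta_smooth.
  by apply: smooth_on_eq (smooth_on_supported oa os supp sf (sI 0 j)) => // q _;
    rewrite [RHS]mxE.
have v_trans a b q : chart_dom M a q -> chart_dom M b q ->
    v b q = v a q *m tangent_trans a b q.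
  move=> aq bq; rewrite /v -scalemxAl -mulmxA.
  have [sq|nsq] := pselect (triv_dom (spinor G) s q); last first.
    by rewrite (supported_in_off supp nsq) !scale0r.
  have := theta_chart sq aq bq; have ua := theta_iso sq aq.
  have ub := theta_iso sq bq => E; congr (_ *: (_ *m _)).
  have : tangent_trans a b q = theta s a q *m invmx (theta s b q).
    by rewrite E mulmxK.
  by move=> ->; rewrite mulKmx.
exists (@VectorField R _ M v v_smooth v_trans); split; last by exists (f p).
move=> t a q tq aq; rewrite /corresponding_form /= /v -scalemxAl I0_scale.
have [sq|nsq] := pselect (triv_dom (spinor G) s q); last first.
  by rewrite (supported_in_off supp nsq) expr0n mul0r.
by rewrite (I0_triv sq tq aq) ?mulr0// mulmxKV// theta_iso.
Qed.

(** In the frame dual to theta, g vanishes on the null cone of the apolar pairing. *)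
Lemma metric_of_null_cone (g : metric M) :
  (forall V : vector_field M, I0_vanishes G V -> forall a p, chart_dom M a p ->
     vf_comp V a p *m metric_comp g a p *m (vf_comp V a p)^T = 0) ->
  forall s a p, triv_dom (spinor G) s p -> chart_dom M a p ->
  exists c, metric_comp g a p = c *: local_metric s a p.
Proof.
move=> gnull s a p sp ap; have uth := theta_iso sp ap.
set th := theta s a p in uth *.
pose S := invmx th *m metric_comp g a p *m (invmx th)^T.
have St : S^T = S by rewrite /S !trmx_mul trmxK (Defs.metric_sym g ap) mulmxA.
have gS : metric_comp g a p = th *m S *m th^T.
  rewrite /S !mulmxA mulmxV// mul1mx -mulmxA -trmx_mul mulmxV// trmx1.
  by rewrite mulmx1.
have [w|c Sc] := apolar_cone St.
  rewrite -I0_apolar => w0.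
  have [V [V0 [c c0 VE]]] := null_field_through sp w0.
  have := gnull V V0 a p ap; rewrite VE linearZ /= -scalemxAr -!scalemxAl scalerA.
  move=> /(congr1 (fun A : 'M[R]_1 => A 0 0)).
  rewrite mxE [RHS]mxE trmx_mul !mulmxA => /eqP.
  by rewrite mulf_eq0 mulf_eq0 (gt_eqF c0) /= => /eqP <-.
by exists c; rewrite gS Sc -scalemxAr -scalemxAl.
Qed.

End GL2.
Unset Implicit Arguments.

Theorem proposition3p2 (R : realType) (k : nat) (hk : (1 <= k)%N)
    (M : manifold R (2 * k).+1) (G : GL2_structure M) :
  exists p q : nat,
    ((p = k.+1 /\ q = k) \/ (p = k /\ q = k.+1)) /\
    exists! C : conformal_structure M,
      conf_signature p q C /\
      (forall V : vector_field M, null C V <-> I0_vanishes G V).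
Proof.
exists (apolar_pos k), (apolar_neg k); split.
  by rewrite /apolar_pos /apolar_neg; case: odd; [right | left].
have [g0 g0E] := exists_global_metric G.
have mx_eq0 (A : 'M[R]_1) : A 0%R 0%R = 0%R -> A = 0%R.
  by move=> A0; apply/matrixP => i j; rewrite !ord1 mxE.
pose C0 := ConformalStructure
  (ex_intro (fun g => _ = [set h | conformal g h]%classic) g0 erefl).
have odd_dim : odd (2 * k).+1 by rewrite /= oddM.
have local_signature s a x : triv_dom (spinor G) s x -> chart_dom M a x ->
    mx_signature (apolar_pos k) (apolar_neg k) (local_metric s a x).
  move=> sx ax; rewrite -[local_metric s a x]scale1r.
  by apply: mx_signature_congr (apolar_signature R k); rewrite ?ltr01 ?theta_iso.
exists C0; split; first split.
- move=> h [f [_ f0 fE]] a x ax; have [s sx] := triv_cover (spinor G) x.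
  have [c c0 cE] := g0E s a x sx ax.
  rewrite fE// cE scalerA; apply: mx_signature_congr (apolar_signature R k).
    by rewrite mulr_gt0.
  exact: theta_iso.
- move=> V; split=> [V0 s a x sx ax | V0 h [f [_ f0 fE]] a x ax].
    have := V0 g0 (conformal_refl g0) a x ax; have [c c0 ->] := g0E s a x sx ax.
    rewrite -scalemxAr -scalemxAl => /(congr1 (fun A : 'M[R]_1 => A 0 0)%R).
    rewrite mxE [RHS]mxE -I0_local_metric => /eqP.
    by rewrite mulf_eq0 (gt_eqF c0) => /eqP.
  have [s sx] := triv_cover (spinor G) x; have [c c0 cE] := g0E s a x sx ax.
  apply: mx_eq0; rewrite fE// cE scalerA -scalemxAr -scalemxAl mxE.
  by rewrite -I0_local_metric V0// mulr0.
move=> C [Csig Cnull]; apply: conf_class_inj => /=.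
have [g CE] := conf_classP C; rewrite CE.
have Cg : conf_class C g by rewrite CE; exact: conformal_refl.
apply: conformal_eq; apply: conformalI => x.
have [s sx] := triv_cover (spinor G) x; have [a ax] := chart_cover x.
have gnull V : I0_vanishes G V -> forall b y, chart_dom M b y ->
    (vf_comp V b y *m metric_comp g b y *m (vf_comp V b y)^T = 0)%R.
  by move=> /Cnull; apply.
have [l lE] := metric_of_null_cone gnull sx ax.
have l0 : (0 < l)%R.
  apply: mx_signature_scale odd_dim (local_signature s a x sx ax) _.
  by rewrite -lE; exact: Csig.
have [c c0 cE] := g0E s a x sx ax.
exists (l / c)%R; first by rewrite divr_gt0.
move=> b bx; rewrite (metric_trans g bx ax) (metric_trans g0 bx ax) lE cE.
by rewrite -!scalemxAr -!scalemxAl scalerA mulfVK// gt_eqF.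
Qed.
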